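(* If $B\subseteq\omega$ is a c.e. set that is nonlow$_2$, then there exists a c.e. set $A\equiv_T B$ such that $\overline{A}$ is not semilow$_2$ (and not semilow$_{1.5}$).
   Context: $\{W_e\}_{e\in\omega}$ is a standard (acceptable) enumeration of the computably enumerable (c.e.) subsets of $\omega$; $\overline{X}=\omega\setminus X$. A set $B$ is low$_2$ if its double jump satisfies $B''\equiv_T\emptyset''$, and nonlow$_2$ otherwise. A set $X\subseteq\omega$ is semilow$_{1.5}$ if $\{e\mid W_e\cap X \text{ is finite}\}\leq_1\emptyset''$ (one-one reducibility). A set $X$ is semilow$_2$ if $\{e\mid W_e\cap X\text{ is infinite}\}\leq_T\emptyset''$. *)

(* Defs.v *)
From Stdlib Require Cantor.
From mathcomp Require Import all_boot.
From mathcomp Require Import boolp classical_sets functions cardinality.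
From mathcomp Require Import zify.

Set Implicit Arguments.
Unset Strict Implicit.
Unset Printing Implicit Defensive.

Local Open Scope classical_set_scope.

Definition pr (a b : nat) : nat := Cantor.to_nat (a, b).

(** Partial recursive functions with an oracle, as unary functions on [nat];
    several arguments are passed through the Cantor pairing [pr]. *)
Inductive code : Type :=
| Zero
| Succ
| Fst
| Snd
| Query
| Pair of code & code
| Comp of code & code
| Rec of code & code
| Mu of code.

(** [eval X c n y]: the program [c] with oracle [X] halts on input [n] with
    output [y].
    [Rec f g] sends [pr a 0] to [f a] and [pr a k.+1] to
    [g (pr a (pr k (Rec f g (pr a k))))].
    [Mu f] sends [n] to the least [y] with [f (pr n y) = 0], provided that
    [f (pr n i)] is defined (and nonzero) for all [i < y]. *)
Fixpoint eval (X : set nat) (c : code) (n y : nat) {struct c} : Prop :=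
  match c with
  | Zero => y = 0
  | Succ => y = n.+1
  | Fst => y = (Cantor.of_nat n).1
  | Snd => y = (Cantor.of_nat n).2
  | Query => (X n /\ y = 1) \/ (~ X n /\ y = 0)
  | Pair f g => exists a b, [/\ eval X f n a, eval X g n b & y = pr a b]
  | Comp f g => exists2 m, eval X g n m & eval X f m y
  | Rec f g =>
      let a := (Cantor.of_nat n).1 in
      (fix loop (k z : nat) {struct k} : Prop :=
         match k with
         | 0 => eval X f a z
         | j.+1 => exists2 w, loop j w & eval X g (pr a (pr j w)) z
         end) (Cantor.of_nat n).2 y
  | Mu f => eval X f (pr n y) 0 /\
            (forall i, i < y -> exists z, eval X f (pr n i) z.+1)
  end.

Lemma eval_fun X c n y z : eval X c n y -> eval X c n z -> y = z.
Proof.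
elim: c n y z => [|||||f IHf g IHg|f IHf g IHg|f IHf g IHg|f IHf] n y z /=.
- by move=> -> ->.
- by move=> -> ->.
- by move=> -> ->.
- by move=> -> ->.
- by move=> [[Xn ->]|[Xn ->]] [[Xn' ->]|[Xn' ->]].
- move=> [a [b [fa gb ->]]] [a' [b' [fa' gb' ->]]].
  by rewrite (IHf _ _ _ fa fa') (IHg _ _ _ gb gb').
- move=> [m gm fm] [m' gm' fm']; rewrite (IHg _ _ _ gm gm') in fm.
  exact: IHf fm fm'.
- elim: (Cantor.of_nat n).2 y z => [|k IHk] y z; first exact: IHf.
  move=> [w hw gw] [w' hw' gw']; rewrite (IHk _ _ hw hw') in gw.
  exact: IHg gw gw'.
- move=> [fy hy] [fz hz]; case: (ltngtP y z) => // [yz|zy].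
  + by have [w fw] := hz _ yz; have := IHf _ _ _ fy fw.
  + by have [w fw] := hy _ zy; have := IHf _ _ _ fz fw.
Qed.

(** Goedel numbering; it is a bijection between [code] and [nat]
    ([encode_inj], [encode_surj]). *)
Fixpoint encode (c : code) : nat :=
  match c with
  | Zero => 0
  | Succ => 1
  | Fst => 2
  | Snd => 3
  | Query => 4
  | Pair f g => 5 + 4 * pr (encode f) (encode g)
  | Comp f g => 6 + 4 * pr (encode f) (encode g)
  | Rec f g => 7 + 4 * pr (encode f) (encode g)
  | Mu f => 8 + 4 * encode f
  end.

(** [Phi X e n y] is Phi_e^X(n) = y. *)
Definition Phi (X : set nat) (e n y : nat) : Prop :=
  exists2 c, encode c = e & eval X c n y.

Definition halts (X : set nat) (e n : nat) : Prop := exists y, Phi X e n y.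

Definition computable (f : nat -> nat) : Prop :=
  exists e, forall n, Phi set0 e n (f n).

Definition turing_le (A B : set nat) : Prop :=
  exists e, forall n, (A n -> Phi B e n 1) /\ (~ A n -> Phi B e n 0).

Definition turing_equiv (A B : set nat) : Prop :=
  turing_le A B /\ turing_le B A.

Definition one_one_le (A B : set nat) : Prop :=
  exists f : nat -> nat,
    [/\ computable f, injective f & forall n, A n <-> B (f n)].

Definition jump (X : set nat) : set nat := [set e | halts X e e].

Definition low2 (B : set nat) : Prop :=
  turing_equiv (jump (jump B)) (jump (jump set0)).

Definition nonlow2 (B : set nat) : Prop := ~ low2 B.

Definition Wstd (e : nat) : set nat := [set n | halts set0 e n].

Definition ce (A : set nat) : Prop := exists e, A = Wstd e.

(** Acceptability in the sense of Rogers: intertranslatable, by computable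
    maps on indices, with the enumeration by Goedel numbers. *)
Definition acceptable (W : nat -> set nat) : Prop :=
  exists f g : nat -> nat,
    [/\ computable f, computable g,
        forall e, W e = Wstd (f e) & forall e, Wstd e = W (g e)].

Definition semilow1_5 (W : nat -> set nat) (X : set nat) : Prop :=
  one_one_le [set e | finite_set (W e `&` X)] (jump (jump set0)).

Definition semilow2 (W : nat -> set nat) (X : set nat) : Prop :=
  turing_le [set e | infinite_set (W e `&` X)] (jump (jump set0)).

Lemma pr_inj a b a' b' : pr a b = pr a' b' -> a = a' /\ b = b'.
Proof. by move=> /Cantor.to_nat_inj [-> ->]. Qed.

Lemma encode_inj : injective encode.
Proof.
elim=> [|||||f IHf g IHg|f IHf g IHg|f IHf g IHg|f IHf]
  [|||||f' g'|f' g'|f' g'|f'] //= E; try lia.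
- by have /pr_inj[/IHf -> /IHg ->] : pr (encode f) (encode g)
    = pr (encode f') (encode g') by lia.
- by have /pr_inj[/IHf -> /IHg ->] : pr (encode f) (encode g)
    = pr (encode f') (encode g') by lia.
- by have /pr_inj[/IHf -> /IHg ->] : pr (encode f) (encode g)
    = pr (encode f') (encode g') by lia.
- by rewrite (IHf f') //; lia.
Qed.

Lemma encode_surj e : exists c, encode c = e.
Proof.
elim/ltn_ind: e => e IH.
case: (ltnP e 5) => [lt5|le5].
  by case: e lt5 {IH} => [|[|[|[|[|e]]]]] // _;
    [exists Zero|exists Succ|exists Fst|exists Snd|exists Query].
set q := (e - 5) %/ 4.
have [a [b qE]] : exists a b, pr a b = q.
  exists (Cantor.of_nat q).1, (Cantor.of_nat q).2.
  by rewrite /pr -surjective_pairing Cantor.cancel_to_of.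
have abq : b + a <= q.
  by rewrite -qE; have := Cantor.to_nat_non_decreasing a b; rewrite /pr; lia.
have [f fE] : exists c, encode c = a by apply: IH; lia.
have [g gE] : exists c, encode c = b by apply: IH; lia.
have [h hE] : exists c, encode c = q by apply: IH; lia.
have : (e - 5) %% 4 < 4 by rewrite ltn_mod.
have eE := divn_eq (e - 5) 4; rewrite -/q in eE.
case r : ((e - 5) %% 4) eE => [|[|[|[|r']]]] // eE _.
- by exists (Pair f g) => /=; rewrite fE gE qE; lia.
- by exists (Comp f g) => /=; rewrite fE gE qE; lia.
- by exists (Rec f g) => /=; rewrite fE gE qE; lia.
- by exists (Mu h) => /=; rewrite hE; lia.
Qed.

Lemma acceptable_Wstd : acceptable Wstd.
Proof.
have cid : computable id.
  exists (encode (Pair Fst Snd)) => n; exists (Pair Fst Snd) => //=.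
  exists (Cantor.of_nat n).1, (Cantor.of_nat n).2; split=> //.
  by rewrite /pr -surjective_pairing Cantor.cancel_to_of.
by exists id, id.
Qed.

(* Main.v *)
(** Let [B_t] be a stage approximation of [B], and let [A] be the set of pairs
    [(t, n)] such that [B_t] and [B] differ at or below [n]; then [A] is c.e. and
    [A] and [B] have the same degree. On the complement of [A], correct
    information about an initial segment of [B] is available, so computations
    relative to [B] truncated at [n] can be carried out there without an oracle.

    Let [K_n] be the set of [q] whose computation from [B] on input [q] halts in
    [n] steps asking only questions below [n]; [K_n] converges pointwise to [B'].
    Hence [e] is in [B''] iff for almost all [n] the [n]-step run of [e] on [e]
    with oracle [K_n] halts and agrees with that of [K_(n+1)]. For each [n] there
    is exactly one [t] with [(t, n)] outside [A] such that [t = 0] or [B_t]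
    differs from [B_(t-1)] at or below [n]; restricting to such pairs, the [n] at which the
    condition fails are counted by [W_(g e)] minus [A], for a computable [g]. So
    [e] is in [B''] iff [W_(g e)] minus [A] is finite, and if the complement of
    [A] were semilow_2 or semilow_1.5 then [B''] would be computable from
    [0'']. *)

Require Import Defs.
From HB Require Import structures.
From mathcomp Require Import all_boot.
From mathcomp Require Import boolp classical_sets functions cardinality.
From mathcomp Require Import zify.

Set Implicit Arguments.
Unset Strict Implicit.
Unset Printing Implicit Defensive.

Local Open Scope classical_set_scope.

(** * Closure properties of oracle-computable functions *)

Definition pi1 (n : nat) : nat := (Cantor.of_nat n).1.
Definition pi2 (n : nat) : nat := (Cantor.of_nat n).2.

Arguments pr : simpl never.
Arguments pi1 : simpl never.
Arguments pi2 : simpl never.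

Lemma pi1_pr a b : pi1 (pr a b) = a.
Proof. by rewrite /pi1 /pr Cantor.cancel_of_to. Qed.

Lemma pi2_pr a b : pi2 (pr a b) = b.
Proof. by rewrite /pi2 /pr Cantor.cancel_of_to. Qed.

Lemma pr_pi n : pr (pi1 n) (pi2 n) = n.
Proof. by rewrite /pi1 /pi2 /pr -surjective_pairing Cantor.cancel_to_of. Qed.

Definition prE := (pi1_pr, pi2_pr).

Definition cmp (X : set nat) (f : nat -> nat) : Prop :=
  exists c, forall n, eval X c n (f n).

Section Closure.
Variable X : set nat.
Implicit Types (f g k s : nat -> nat) (p q : nat -> bool).

Lemma eq_cmp f g : f =1 g -> cmp X f -> cmp X g.
Proof. by move=> fg [c cf]; exists c => n; rewrite -fg. Qed.

Lemma cmp_comp f g : cmp X f -> cmp X g -> cmp X (fun n => f (g n)).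
Proof. by move=> [c cf] [d dg]; exists (Comp c d) => n; exists (g n). Qed.

Lemma cmp_pr f g : cmp X f -> cmp X g -> cmp X (fun n => pr (f n) (g n)).
Proof.
by move=> [c cf] [d dg]; exists (Pair c d) => n; exists (f n), (g n).
Qed.

Lemma cmp_pi1 f : cmp X f -> cmp X (fun n => pi1 (f n)).
Proof. by apply: cmp_comp; exists Fst. Qed.

Lemma cmp_pi2 f : cmp X f -> cmp X (fun n => pi2 (f n)).
Proof. by apply: cmp_comp; exists Snd. Qed.

Lemma cmp_succ f : cmp X f -> cmp X (fun n => (f n).+1).
Proof. by apply: cmp_comp; exists Succ. Qed.

Lemma cmp_id : cmp X (fun n => n).
Proof.
by apply: (eq_cmp pr_pi); apply: cmp_pr; [exists Fst | exists Snd].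
Qed.

Lemma cmp_cst a : cmp X (fun=> a).
Proof. by elim: a => [|a IH]; [exists Zero | exact: cmp_succ]. Qed.

Lemma cmp2_comp (F : nat -> nat -> nat) f g :
  cmp X (fun z => F (pi1 z) (pi2 z)) -> cmp X f -> cmp X g ->
  cmp X (fun n => F (f n) (g n)).
Proof.
move=> cF cf cg; have /eq_cmp := cmp_comp cF (cmp_pr cf cg).
by apply=> n /=; rewrite !prE.
Qed.

(** [Rec] passes parameter, counter and accumulator as a nested pair, which dictates the shape of
    the hypothesis on [G]. Arithmetic, bounded quantifiers and machine runs all come from this
    scheme. *)
Lemma cmp_iteri (G : nat -> nat -> nat -> nat) k s :
  cmp X (fun z => G (pi1 z) (pi1 (pi2 z)) (pi2 (pi2 z))) ->
  cmp X k -> cmp X s -> cmp X (fun n => iteri (k n) (G n) (s n)).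
Proof.
move=> [cG hG] ck [cs hs].
refine (cmp2_comp (F := fun n j => iteri j (G n) (s n)) _ cmp_id ck).
exists (Rec cs cG) => z /=; rewrite -/(pi1 z) -/(pi2 z).
elim: (pi2 z) => [|j IH] //=.
exists (iteri j (G (pi1 z)) (s (pi1 z))) => //.
by have := hG (pr (pi1 z) (pr j (iteri j (G (pi1 z)) (s (pi1 z))))); rewrite !prE.
Qed.

Lemma cmp_iter (G : nat -> nat -> nat) k s :
  cmp X (fun z => G (pi1 z) (pi2 z)) -> cmp X k -> cmp X s ->
  cmp X (fun n => iter (k n) (G n) (s n)).
Proof.
move=> cG ck cs; apply: (eq_cmp (f := fun n => iteri (k n) (fun=> G n) (s n))).
  by move=> n; elim: (k n) => //= j ->.
apply: (@cmp_iteri (fun n _ => G n)) => //.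
refine (cmp2_comp cG _ _); do ?[exact: cmp_id | apply: cmp_pi1 | apply: cmp_pi2].
Qed.

Lemma cmp_pred f : cmp X f -> cmp X (fun n => (f n).-1).
Proof.
apply: (@cmp_comp predn).
apply: (eq_cmp (f := fun n => iteri n (fun i _ => i) 0)); first by case.
apply: (@cmp_iteri (fun _ i _ => i)); [|exact: cmp_id|exact: cmp_cst].
exact/cmp_pi1/cmp_pi2/cmp_id.
Qed.

Lemma cmp_add f g : cmp X f -> cmp X g -> cmp X (fun n => f n + g n).
Proof.
move=> cf cg; apply: (eq_cmp (f := fun n => iter (f n) succn (g n))).
  by move=> n; rewrite iter_succn addnC.
by apply: (@cmp_iter (fun=> succn)) => //; apply/cmp_succ/cmp_pi2/cmp_id.
Qed.

Lemma cmp_sub f g : cmp X f -> cmp X g -> cmp X (fun n => f n - g n).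
Proof.
move=> cf cg; apply: (eq_cmp (f := fun n => iter (g n) predn (f n))).
  by move=> n; rewrite iter_predn.
by apply: (@cmp_iter (fun=> predn)) => //; apply/cmp_pred/cmp_pi2/cmp_id.
Qed.

Lemma cmp_mul f g : cmp X f -> cmp X g -> cmp X (fun n => f n * g n).
Proof.
move=> cf cg; apply: (eq_cmp (f := fun n => iter (f n) (addn (g n)) 0)).
  by move=> n; rewrite iter_addn_0 mulnC.
apply: (@cmp_iter (fun n w => g n + w)) => //; last exact: cmp_cst.
by apply: cmp_add; [apply: cmp_comp cg _; apply: cmp_pi1|apply: cmp_pi2]; exact: cmp_id.
Qed.

Definition cmpb p := cmp X (fun n => nat_of_bool (p n)).

Lemma cmpb_leq f g : cmp X f -> cmp X g -> cmpb (fun n => f n <= g n).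
Proof.
move=> cf cg; apply: (eq_cmp (f := fun n => 1 - (f n - g n))); first by move=> n; lia.
by do 2?apply: cmp_sub => //; exact: cmp_cst.
Qed.

Lemma cmpb_and p q : cmpb p -> cmpb q -> cmpb (fun n => p n && q n).
Proof.
move=> cp cq; apply: eq_cmp (cmp_mul cp cq) => n.
by rewrite mulnb.
Qed.

Lemma cmpb_neg p : cmpb p -> cmpb (fun n => ~~ p n).
Proof.
move=> cp; apply: eq_cmp (cmp_sub (cmp_cst 1) cp) => n.
by case: (p n).
Qed.

Lemma cmpb_or p q : cmpb p -> cmpb q -> cmpb (fun n => p n || q n).
Proof.
move=> cp cq; apply: eq_cmp (cmpb_neg (cmpb_and (cmpb_neg cp) (cmpb_neg cq))) => n.
by rewrite -negb_or negbK.
Qed.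

Lemma cmpb_eq f g : cmp X f -> cmp X g -> cmpb (fun n => f n == g n).
Proof.
move=> cf cg; apply: eq_cmp (cmpb_and (cmpb_leq cf cg) (cmpb_leq cg cf)) => n.
by rewrite eqn_leq.
Qed.

Lemma cmp_if p f g : cmpb p -> cmp X f -> cmp X g ->
  cmp X (fun n => if p n then f n else g n).
Proof.
move=> cp cf cg.
apply: eq_cmp (cmp_add (cmp_mul cp cf) (cmp_mul (cmpb_neg cp) cg)) => n.
by case: (p n); lia.
Qed.

Lemma cmpb_all (P : nat -> nat -> bool) k :
  cmpb (fun z => P (pi1 z) (pi2 z)) -> cmp X k ->
  cmpb (fun n => all (P n) (iota 0 (k n))).
Proof.
move=> cP ck; apply: (eq_cmp (f := fun n => iteri (k n) (fun i w => P n i * w) 1)).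
  move=> n /=; elim: (k n) => // j IH.
  by rewrite iteriS IH -addn1 iotaD all_cat /= andbT mulnb andbC.
apply: (@cmp_iteri (fun n i w => P n i * w)) ck (cmp_cst 1).
apply: cmp_mul; last exact/cmp_pi2/cmp_pi2/cmp_id.
apply: (@cmp2_comp (fun n i => P n i)) => //; first exact/cmp_pi1/cmp_id.
exact/cmp_pi1/cmp_pi2/cmp_id.
Qed.

(** [Mu] stops at a zero, so the program searched is one for the negation of [P]. *)
Lemma cmp_mu (P : nat -> nat -> bool) f :
  cmpb (fun z => P (pi1 z) (pi2 z)) ->
  (forall n, P n (f n) /\ forall i, i < f n -> ~~ P n i) -> cmp X f.
Proof.
move=> /cmpb_neg [c cP] Pf; exists (Mu c) => n /=.
have [Pn Pmin] := Pf n; split.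
  by have := cP (pr n (f n)); rewrite !prE Pn.
move=> i /Pmin Pi; exists 0.
by have := cP (pr n i); rewrite !prE Pi.
Qed.

(** Projections of decidable relations are domains of programs: an unbounded search halts exactly
    where a witness exists. *)
Lemma cmp_dom (P : nat -> nat -> bool) :
  cmpb (fun z => P (pi1 z) (pi2 z)) ->
  exists c, forall n, (exists y, eval X c n y) <-> exists y, P n y.
Proof.
move=> /cmpb_neg [c cP]; exists (Mu c) => n.
have {}cP y : eval X c (pr n y) (~~ P n y).
  by have := cP (pr n y); rewrite !prE.
split=> -[y Py].
  exists y; have [/= cy _] := Py.
  by have := eval_fun cy (cP y); case: (P n y).
case: (ex_minnP (ex_intro (fun y => P n y) y Py)) => m Pm Pmin; exists m; split.
  by have := cP m; rewrite Pm.
move=> i im; exists 0; have := cP i.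
by case: (boolP (P n i)) => // /Pmin; lia.
Qed.

(** Division by 4 decodes Goedel numbers of composite programs; the quotient is the least [m] with
    [n <= 4 * m + 3]. *)
Lemma cmp_divn4 f : cmp X f -> cmp X (fun n => f n %/ 4).
Proof.
apply: (@cmp_comp (divn^~ 4)).
apply: (@cmp_mu (fun n m => n <= 4 * m + 3)); last by move=> n; split; lia.
apply: cmpb_leq; first exact/cmp_pi1/cmp_id.
by apply: cmp_add (cmp_cst 3); apply: cmp_mul (cmp_cst 4) _; exact/cmp_pi2/cmp_id.
Qed.

Lemma cmp_modn4 f : cmp X f -> cmp X (fun n => f n %% 4).
Proof.
move=> cf; apply: (eq_cmp (f := fun n => f n - 4 * (f n %/ 4))); first by move=> n; lia.
exact/(cmp_sub cf)/(cmp_mul (cmp_cst 4))/cmp_divn4.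
Qed.

End Closure.

Ltac cmp_tac :=
  rewrite /cmpb; cbv beta;
  first [assumption | simple apply cmp_id | simple apply cmp_cst |
  lazymatch goal with
  | |- cmp _ pi1 => exact: (cmp_pi1 (@cmp_id _))
  | |- cmp _ pi2 => exact: (cmp_pi2 (@cmp_id _))
  | |- cmp ?X (fun n => pi1 (@?f n)) => apply: (@cmp_pi1 X f); cmp_tac
  | |- cmp ?X (fun n => pi2 (@?f n)) => apply: (@cmp_pi2 X f); cmp_tac
  | |- cmp ?X (fun n => S (@?f n)) => apply: (@cmp_succ X f); cmp_tac
  | |- cmp ?X (fun n => predn (@?f n)) => apply: (@cmp_pred X f); cmp_tac
  | |- cmp ?X (fun n => pr (@?f n) (@?g n)) => apply: (@cmp_pr X f g); cmp_tac
  | |- cmp ?X (fun n => (@?f n) + (@?g n)) => apply: (@cmp_add X f g); cmp_tac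
  | |- cmp ?X (fun n => (@?f n) - (@?g n)) => apply: (@cmp_sub X f g); cmp_tac
  | |- cmp ?X (fun n => (@?f n) * (@?g n)) => apply: (@cmp_mul X f g); cmp_tac
  | |- cmp ?X (fun n => (@?f n) %/ 4) => apply: (@cmp_divn4 X f); cmp_tac
  | |- cmp ?X (fun n => (@?f n) %% 4) => apply: (@cmp_modn4 X f); cmp_tac
  | |- cmp ?X (fun n => nat_of_bool ((@?f n) <= (@?g n))) =>
      apply: (@cmpb_leq X f g); cmp_tac
  | |- cmp ?X (fun n => nat_of_bool ((@?f n) == (@?g n))) =>
      apply: (@cmpb_eq X f g); cmp_tac
  | |- cmp ?X (fun n => nat_of_bool ((@?f n) && (@?g n))) =>
      apply: (@cmpb_and X f g); cmp_tac
  | |- cmp ?X (fun n => nat_of_bool ((@?f n) || (@?g n))) =>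
      apply: (@cmpb_or X f g); cmp_tac
  | |- cmp ?X (fun n => nat_of_bool (~~ (@?f n))) =>
      apply: (@cmpb_neg X f); cmp_tac
  | |- cmp _ (fun n => if _ then _ else _) => apply: cmp_if; cmp_tac
  | |- _ => idtac
  end].

(** * Turing reducibility, oracle substitution and constant programs *)

Definition chi (X : set nat) (n : nat) : nat := `[< X n >].

Lemma chi_set0 : chi set0 = fun=> 0.
Proof. by apply: funext => n; rewrite /chi asboolF. Qed.

Lemma turing_leE A B : turing_le A B <-> cmp B (chi A).
Proof.
split=> [[e eP]|[c cP]].
  have [c cE] := encode_surj e; exists c => n; rewrite /chi.
  by case: asboolP => [/(proj1 (eP n))|/(proj2 (eP n))] [d dE dn];
    rewrite -(encode_inj (etrans dE (esym cE))).
exists (encode c) => n; have := cP n; rewrite /chi.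
by case: asboolP => // An cn; split=> // _; exists c.
Qed.

Lemma computableE f : computable f <-> cmp set0 f.
Proof.
split=> [[e eP]|[c cP]]; last by exists (encode c) => n; exists c.
have [c cE] := encode_surj e; exists c => n.
by have [d dE dn] := eP n; rewrite -(encode_inj (etrans dE (esym cE))).
Qed.

Lemma cmp_oracle X : cmp X (chi X).
Proof. by exists Query => n; rewrite /= /chi; case: asboolP => ?; [left|right]. Qed.

Fixpoint osubst (q c : code) : code :=
  match c with
  | Query => q
  | Pair f g => Pair (osubst q f) (osubst q g)
  | Comp f g => Comp (osubst q f) (osubst q g)
  | Rec f g => Rec (osubst q f) (osubst q g)
  | Mu f => Mu (osubst q f)
  | _ => c
  end.

(** Replacing each oracle call by a program for the oracle makes relative computability
    transitive. *)
Lemma eval_osubst X Y q c n y : (forall n, eval Y q n (chi X n)) ->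
  eval X c n y -> eval Y (osubst q c) n y.
Proof.
move=> qP; elim: c n y => [|||||f IHf g IHg|f IHf g IHg|f IHf g IHg|f IHf] n y //=.
- by have := qP n; rewrite /chi; case: asboolP => Xn qn [[? ->]|[? ->]].
- by move=> [a [b [/IHf fa /IHg gb ->]]]; exists a, b.
- by move=> [m /IHg gm /IHf fm]; exists m.
- elim: (Cantor.of_nat n).2 y => [|k IH] y; first exact: IHf.
  by move=> [w /IH hw /IHg gw]; exists w.
- by move=> [/IHf fy fi]; split=> // i /fi [z /IHf fz]; exists z.
Qed.

Lemma cmp_trans X Y f : cmp Y (chi X) -> cmp X f -> cmp Y f.
Proof. by move=> [q qP] [c cP]; exists (osubst q c) => n; exact: eval_osubst. Qed.

Lemma cmp_set0 X f : cmp set0 f -> cmp X f.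
Proof. by apply: cmp_trans; rewrite chi_set0; exact: cmp_cst. Qed.

Fixpoint kst (a : nat) : code := if a is b.+1 then Comp Succ (kst b) else Zero.

Lemma eval_kst X a n y : eval X (kst a) n y <-> y = a.
Proof.
elim: a y => //= a IH y; split=> [[m /IH -> //]|->].
by exists a => //; apply/IH.
Qed.

Lemma cmp_kst X f : cmp X f -> cmp X (fun n => encode (kst (f n))).
Proof.
apply: (@cmp_comp _ (fun a => encode (kst a))).
(* [6 + 4 * pr 1 w] is the number of [Comp Succ d] when [w] is that of [d], and 0 is the number of
   [Zero]. *)
apply: (eq_cmp (f := fun a => iter a (fun w => 6 + 4 * pr 1 w) 0)).
  by elim=> //= a ->.
by apply: (@cmp_iter _ (fun _ w => 6 + 4 * pr 1 w)); cmp_tac.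
Qed.

Lemma halts_encode X c n : halts X (encode c) n <-> exists y, eval X c n y.
Proof.
split=> -[y]; last by move=> cy; exists y, c.
by move=> [d /encode_inj -> dy]; exists y.
Qed.

(** * A stack machine for oracle programs, acting on numbers *)

Definition ret (v K : nat) : nat := pr 0 (pr v K).
Definition ev (e v K : nat) : nat := pr e.+1 (pr v K).
(** The successor keeps 0 free for the empty stack. *)
Definition push (t p K : nat) : nat := (pr (pr t p) K).+1.
Definition arg (s : nat) : nat := pi1 (pi2 s).
Definition stk (s : nat) : nat := pi2 (pi2 s).
Definition halted (s : nat) : bool := (pi1 s == 0) && (stk s == 0).

(* Frames: [t = 0] pairs [p] with the value, [t = 1] holds the second component
   of [Pair] and its input, [t = 2] the outer program of [Comp], and [t = 3]
   a program searched by [Mu], its input, and the current candidate. *)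
Definition resume (t p v K : nat) : nat :=
  if t == 0 then ret (pr p v) K
  else if t == 1 then ev (pi1 p) (pi2 p) (push 0 v K)
  else if t == 2 then ev p v K
  else if v == 0 then ret (pi2 (pi2 p)) K
  else ev (pi1 p) (pr (pi1 (pi2 p)) (pi2 (pi2 p)).+1)
         (push 3 (pr (pi1 p) (pr (pi1 (pi2 p)) (pi2 (pi2 p)).+1)) K).

(** The residue [r] selects [Pair], [Comp], [Rec] or [Mu], and [q] holds the subprograms. The three
    frames of a recursive step turn the preceding value [w] into [pr (pi1 v) (pr (pi2 v).-1 w)] and
    hand it to the step program. *)
Definition step4 (q r e v K : nat) : nat :=
  if r == 0 then ev (pi1 q) v (push 1 (pr (pi2 q) v) K)
  else if r == 1 then ev (pi2 q) v (push 2 (pi1 q) K)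
  else if r == 2 then
    if pi2 v == 0 then ev (pi1 q) (pi1 v) K
    else ev e (pr (pi1 v) (pi2 v).-1)
           (push 0 (pi2 v).-1 (push 0 (pi1 v) (push 2 (pi2 q) K)))
  else ev q (pr v 0) (push 3 (pr q (pr v 0)) K).

(* The state is [pr 0 (pr v K)] when the value [v] is returned to the stack [K]
   and [pr e.+1 (pr n K)] when the program [e] is to be run on [n]. The oracle
   [h] answers [0] or [1]; on any other answer the machine is stuck in a state
   that is not halted. Locking keeps unification from unfolding [step], which
   does not terminate in practice. *)
HB.lock Definition step (h : nat -> nat) (s : nat) : nat :=
  let v := arg s in
  let K := stk s in
  if pi1 s == 0 then
    if K == 0 then s
    else resume (pi1 (pi1 K.-1)) (pi2 (pi1 K.-1)) v (pi2 K.-1)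
  else
    let e := (pi1 s).-1 in
    if e == 0 then ret 0 K
    else if e == 1 then ret v.+1 K
    else if e == 2 then ret (pi1 v) K
    else if e == 3 then ret (pi2 v) K
    else if e == 4 then if h v <= 1 then ret (h v) K else s
    else step4 ((e - 5) %/ 4) ((e - 5) %% 4) e v K.

Definition run (h : nat -> nat) (k s : nat) : nat := iter k (step h) s.

Definition stops (h : nat -> nat) (k e n : nat) : bool :=
  halted (run h k (ev e n 0)).

(** The oracle may vary with a parameter, as needed when it is itself a stage of an
    approximation. *)
Lemma cmp_step X (H : nat -> nat -> nat) :
  cmp X (fun z => H (pi1 z) (pi2 z)) ->
  cmp X (fun z => step (H (pi1 z)) (pi2 z)).
Proof.
move=> cH; rewrite step.unlock /resume /step4 /ev /ret /push /arg /stk; cmp_tac.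
all: refine (cmp2_comp (F := H) cH _ _); cmp_tac.
Qed.

Lemma cmp_run X (H : nat -> nat -> nat) k s :
  cmp X (fun z => H (pi1 z) (pi2 z)) -> cmp X k -> cmp X s ->
  cmp X (fun n => run (H n) (k n) (s n)).
Proof. by move=> cH; apply: cmp_iter; exact: cmp_step. Qed.

Lemma cmp_stops X (H : nat -> nat -> nat) k e m :
  cmp X (fun z => H (pi1 z) (pi2 z)) -> cmp X k -> cmp X e -> cmp X m ->
  cmpb X (fun n => stops (H n) (k n) (e n) (m n)).
Proof.
move=> cH ck ce cm.
have cr : cmp X (fun n => run (H n) (k n) (ev (e n) (m n) 0)).
  by apply: cmp_run => //; rewrite /ev; cmp_tac.
refine (@cmp_comp X (fun s => halted s) _ _ cr).
by rewrite /halted /stk; cmp_tac.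
Qed.

Lemma halted_step h s : halted s -> step h s = s.
Proof. by rewrite /halted step.unlock => /andP[/eqP -> /eqP ->]. Qed.

Lemma run_fix h k s : step h s = s -> run h k s = s.
Proof. by move=> sE; rewrite /run; elim: k => // k; rewrite iterS => ->. Qed.

Lemma run_halted h k s : halted s -> run h k s = s.
Proof. by move=> /(halted_step h); exact: run_fix. Qed.

Lemma runD h j k s : run h (j + k) s = run h k (run h j s).
Proof. by rewrite /run addnC iterD. Qed.

Lemma runS h k s : run h k.+1 s = run h k (step h s).
Proof. by rewrite /run iterSr. Qed.

Lemma run_stable h j k s : j <= k -> halted (run h j s) -> run h k s = run h j s.
Proof. by move=> /subnKC <- hj; rewrite runD run_halted. Qed.

Lemma stops_mono h j k e n : j <= k -> stops h j e n -> stops h k e n.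
Proof. by move=> jk sj; rewrite /stops (run_stable jk). Qed.

(** * Correctness of the machine *)

Section Simulation.
Variable X : set nat.
Let h := chi X.

Lemma step_ev c n K :
  step h (ev (encode c) n K) =
  match c with
  | Zero => ret 0 K
  | Succ => ret n.+1 K
  | Fst => ret (pi1 n) K
  | Snd => ret (pi2 n) K
  | Query => ret (h n) K
  | Pair f g => ev (encode f) n (push 1 (pr (encode g) n) K)
  | Comp f g => ev (encode g) n (push 2 (encode f) K)
  | Rec f g =>
      if pi2 n is j.+1 then
        ev (encode c) (pr (pi1 n) j)
          (push 0 j (push 0 (pi1 n) (push 2 (encode g) K)))
      else ev (encode f) (pi1 n) K
  | Mu f => ev (encode f) (pr n 0) (push 3 (pr (encode f) (pr n 0)) K)
  end.
Proof.
rewrite step.unlock /arg /stk /ev !prE.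
have dec q r : r < 4 -> ((5 + r + 4 * q - 5) %/ 4 = q) /\ ((5 + r + 4 * q - 5) %% 4 = r).
  by move=> r4; lia.
case: c => [|||||f g|f g|f g|f] //=.
- by rewrite /h /chi; case: asboolP.
- by have [-> ->] := dec (pr (encode f) (encode g)) 0 isT; rewrite /step4 /= !prE.
- by have [-> ->] := dec (pr (encode f) (encode g)) 1 isT; rewrite /step4 /= !prE.
- have [-> ->] := dec (pr (encode f) (encode g)) 2 isT; rewrite /step4 /= !prE.
  by case: (pi2 n).
- by have [-> ->] := dec (encode f) 3 isT.
Qed.

Lemma step_ret v t p K : step h (ret v (push t p K)) = resume t p v K.
Proof. by rewrite step.unlock /arg /stk /ret /push !prE. Qed.

Lemma halted_ret v K : halted (ret v K) = (K == 0).
Proof. by rewrite /halted /stk /ret !prE. Qed.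

Lemma halted_ev e n K : halted (ev e n K) = false.
Proof. by rewrite /halted /ev prE. Qed.

(** The stack is arbitrary so that the induction hypotheses apply to subcomputations with pending
    frames. *)
Lemma eval_run c n y K :
  eval X c n y -> exists k, run h k (ev (encode c) n K) = ret y K.
Proof.
have step1 s t u : step h s = t -> (exists k, run h k t = u) -> exists k, run h k s = u.
  by move=> st [k ku]; exists k.+1; rewrite runS st.
have steps s t u : (exists k, run h k s = t) -> (exists k, run h k t = u) ->
    exists k, run h k s = u.
  by move=> [j js] [k ku]; exists (j + k); rewrite runD js.
elim: c n y K => [|||||f IHf g IHg|f IHf g IHg|f IHf g IHg|f IHf] n y K E;
  apply: (step1 _ _ _ (step_ev _ _ _)).
- by exists 0; rewrite E.
- by exists 0; rewrite E.
- by exists 0; rewrite E.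
- by exists 0; rewrite E.
- by exists 0; rewrite /h /chi; move: E => /= [] [Xn ->]; case: asboolP.
- have [a [b [fa gb ->]]] := E.
  apply: (steps _ _ _ (IHf _ _ _ fa)); apply: (step1 _ _ _ (step_ret _ _ _ _)).
  rewrite /resume /= !prE; apply: (steps _ _ _ (IHg _ _ _ gb)).
  by apply: (step1 _ _ _ (step_ret _ _ _ _)); exists 0.
- have [m gm fm] := E.
  apply: (steps _ _ _ (IHg _ _ _ gm)); apply: (step1 _ _ _ (step_ret _ _ _ _)).
  exact: IHf.
- rewrite -(pr_pi n) !prE; move: E => /=; rewrite -/(pi1 n) -/(pi2 n).
  elim: (pi2 n) y K => [|j IH] y K; first exact: IHf.
  move=> [w /IH hw gw].
  apply: (@steps _ (ret w (push 0 j (push 0 (pi1 n) (push 2 (encode g) K))))).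
    by apply: (step1 _ _ _ (step_ev (Rec f g) _ _)); rewrite !prE; exact: hw.
  apply: (step1 _ _ _ (step_ret _ _ _ _)); rewrite /resume /=.
  apply: (step1 _ _ _ (step_ret _ _ _ _)); rewrite /resume /=.
  apply: (step1 _ _ _ (step_ret _ _ _ _)); rewrite /resume /=.
  exact: IHg.
- have [fy fi] := E.
  (* Induction on the distance from the candidate [i] to the least zero [y]. *)
  have : forall d i, d + i = y -> exists k,
    run h k (ev (encode f) (pr n i) (push 3 (pr (encode f) (pr n i)) K)) = ret y K.
    elim=> [|d IH] i di.
      move: di; rewrite add0n => ->; apply: (steps _ _ _ (IHf _ _ _ fy)).
      by apply: (step1 _ _ _ (step_ret _ _ _ _)); rewrite /resume /= !prE; exists 0.
    have [|z fz] := fi i; first lia.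
    apply: (steps _ _ _ (IHf _ _ _ fz)).
    apply: (step1 _ _ _ (step_ret _ _ _ _)); rewrite /resume /= !prE.
    by apply: IH; lia.
  by apply; exact: addn0.
Qed.

(** The bound [j <= k] on the remaining steps provides the measure for the [Mu] search, whose number
    of candidates is not known in advance. *)
Lemma run_eval c n K k : halted (run h k (ev (encode c) n K)) ->
  exists y j, [/\ j <= k, eval X c n y & halted (run h j (ret y K))].
Proof.
have fst_step k' s : ~~ halted s -> halted (run h k' s) ->
    exists2 j, j < k' & halted (run h j (step h s)).
  by case: k' => [|j] /negP ns; [move=> /ns | rewrite runS => hj; exists j].
have evs c' n' K' k' : halted (run h k' (ev (encode c') n' K')) ->
    exists2 j, j < k' & halted (run h j (step h (ev (encode c') n' K'))).
  by apply: fst_step; rewrite halted_ev.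
have rets v t p K' k' : halted (run h k' (ret v (push t p K'))) ->
    exists2 j, j < k' & halted (run h j (resume t p v K')).
  by move=> /fst_step; rewrite halted_ret step_ret; apply.
elim: c n K k => [|||||f IHf g IHg|f IHf g IHg|f IHf g IHg|f IHf] n K k /evs [j jk];
  rewrite step_ev.
- by move=> hj; exists 0, j; split; [exact: ltnW| |].
- by move=> hj; exists n.+1, j; split; [exact: ltnW| |].
- by move=> hj; exists (pi1 n), j; split; [exact: ltnW| |].
- by move=> hj; exists (pi2 n), j; split; [exact: ltnW| |].
- move=> hj; exists (h n), j; split; [exact: ltnW| |by []].
  by rewrite /= /h /chi; case: asboolP => ?; [left|right].
- move=> /IHf [a [j1 [j1j fa /rets [j2 j21]]]]; rewrite /resume /= !prE.
  move=> /IHg [b [j3 [j32 gb /rets [j4 j43]]]]; rewrite /resume /= => h4.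
  exists (pr a b), j4; split=> //; last by exists a, b.
  lia.
- move=> /IHg [m [j1 [j1j gm /rets [j2 j21]]]]; rewrite /resume /=.
  move=> /IHf [y [j3 [j32 fy h3]]].
  by exists y, j3; split=> //; [lia|exists m].
- rewrite /= -/(pi1 n) -/(pi2 n).
  have : halted (run h j (if pi2 n is i.+1 then
        ev (encode (Rec f g)) (pr (pi1 n) i)
          (push 0 i (push 0 (pi1 n) (push 2 (encode g) K)))
      else ev (encode f) (pi1 n) K)) -> exists y i,
     [/\ i <= j, eval X (Rec f g) n y & halted (run h i (ret y K))].
    rewrite -{3}(pr_pi n) /= -/(pi1 _) -/(pi2 _) !prE.
    elim: (pi2 n) j {jk} K => [|i IH] j K; first exact: IHf.
    move=> /(evs (Rec f g)) [j0 j0j]; rewrite step_ev !prE.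
    move=> /IH [w [j1 [j1j fw /rets [j2 j21]]]]; rewrite /resume /=.
    move=> /rets [j3 j32]; rewrite /resume /=.
    move=> /rets [j4 j43]; rewrite /resume /=.
    move=> /IHg [y [j5 [j54 gy h5]]].
    by exists y, j5; split=> //; [lia|exists w].
  move=> H /H [y [i [ij fy hi]]]; exists y, i; split=> //; lia.
- have : forall i, (forall i', i' < i -> exists z, eval X f (pr n i') z.+1) ->
     halted (run h j (ev (encode f) (pr n i) (push 3 (pr (encode f) (pr n i)) K))) ->
     exists y j', [/\ j' <= j, eval X (Mu f) n y & halted (run h j' (ret y K))].
    elim/ltn_ind: j {jk} => j IH i fi.
    move=> /IHf [v [j1 [j1j fv /rets [j2 j21]]]]; rewrite /resume /= !prE.
    case: v fv => [|v] fv /= h2; first by exists i, j2; split=> //; lia.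
    have [||y [j' [j'2 fy hy]]] := IH j2 _ i.+1 _ h2.
    + lia.
    + move=> i'; rewrite ltnS leq_eqVlt => /orP[/eqP ->|/fi //].
      by exists v.
    + by exists y, j'; split=> //; lia.
  move=> /(_ 0) H /H [//|y [j' [j'j fy hy]]].
  by exists y, j'; split=> //; lia.
Qed.

End Simulation.

(** * Halting by step counts and monotonicity of the jump *)

Lemma halts_stops X e n : halts X e n <-> exists k, stops (chi X) k e n.
Proof.
have [c <-] := encode_surj e; rewrite halts_encode; split=> [[y /eval_run]|[k]].
  by move=> /(_ 0) [k ky]; exists k; rewrite /stops ky halted_ret.
by move=> /run_eval [y [j [_ cy _]]]; exists y.
Qed.

(** Halting relative to [X] is a search relative to [Y]. With [e] plugged in by [kst], the search
    program ignores its input, so its diagonal halting question is the one wanted. *)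
Lemma jump_mono X Y : turing_le X Y -> turing_le (jump X) (jump Y).
Proof.
move=> /turing_leE cXY.
have [|u uP] := @cmp_dom Y (fun e k => stops (chi X) k e e).
  apply: (@cmp_stops _ (fun _ q => chi X q)); cmp_tac.
  by apply: cmp_comp cXY _; cmp_tac.
apply/turing_leE.
apply: (eq_cmp (f := fun e => chi (jump Y) (encode (Comp u (kst e))))).
  move=> e; congr nat_of_bool; apply: asbool_equiv_eq.
  split=> [/halts_encode[y [_ /eval_kst -> uy]]|/halts_stops/uP[y uy]].
    by apply/halts_stops/uP; exists y.
  by apply/halts_encode; exists y, e => //; exact/eval_kst.
apply: cmp_comp (@cmp_oracle _) _ => /=.
by cmp_tac; exact/cmp_kst/cmp_id.
Qed.

(** * Dependence of runs on the oracle, and limits of oracles *)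

Lemma step_approx h h' s : (forall x, h x <= 1 -> h' x = h x) ->
  step h s = s \/ step h' s = step h s.
Proof.
move=> hh'; rewrite step.unlock; cbv zeta.
case: (pi1 s == 0); first exact: or_intror (erefl _).
do 4![case: (_.-1 == _); first exact: or_intror (erefl _)].
case: (_.-1 == 4); last exact: or_intror (erefl _).
case: ifP => [hv|_]; last exact: or_introl (erefl _).
by rewrite (hh' _ hv) hv; exact: or_intror (erefl _).
Qed.

(** A use principle: at an improper answer of [h] the machine would stay forever in a state that is
    not halted, so a halting run sees only answers shared with [h']. *)
Lemma run_approx h h' k s : (forall x, h x <= 1 -> h' x = h x) ->
  halted (run h k s) -> run h' k s = run h k s.
Proof.
move=> hh'; elim: k s => // k IH s; rewrite !runS.
have [sE|->] := step_approx s hh'; last exact: IH.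
rewrite sE (run_fix k sE) => hs; rewrite (halted_step h' hs).
exact: run_halted.
Qed.

Lemma step_ext h h' s : h (arg s) = h' (arg s) -> step h s = step h' s.
Proof. by move=> hh'; rewrite !step.unlock; cbv zeta; rewrite hh'. Qed.

Definition eventually (P : nat -> Prop) : Prop :=
  exists N, forall n, N <= n -> P n.

Definition converges (h_ : nat -> nat -> nat) (h : nat -> nat) : Prop :=
  forall x, eventually (fun n => h_ n x = h x).

(** A run of fixed length asks at most one question per step, at [arg] of the current state. *)
Lemma run_converges h_ h i s : converges h_ h ->
  eventually (fun n => run (h_ n) i s = run h i s).
Proof.
move=> cvg; elim: i => [|i [N IH]]; first by exists 0.
have [M MP] := cvg (arg (run h i s)); exists (maxn N M) => n.
rewrite geq_max => /andP[Nn Mn]; rewrite /run !iterS -/(run _ _ _) -/(run _ _ _).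
by rewrite IH //; apply: step_ext; exact: MP.
Qed.

(** Comparing runs at every length up to [n] allows agreements for different [n] to be chained at
    one fixed length. *)
Definition settled (h h' : nat -> nat) (n e : nat) : bool :=
  stops h n e e &&
  all (fun i => run h i (ev e e 0) == run h' i (ev e e 0)) (iota 0 n.+1).

Lemma settledP h_ h e : converges h_ h ->
  (exists k, stops h k e e) <->
  eventually (fun n => settled (h_ n) (h_ n.+1) n e).
Proof.
move=> cvg; split=> [[k hk]|[N settles]].
  have [N NP] := run_converges k (ev e e 0) cvg.
  have conv : eventually (fun n => forall i, i <= k ->
      run (h_ n) i (ev e e 0) = run h i (ev e e 0)).
    elim: (k) => [|j [M MP]]; first by exists 0 => n _ [].
    have [M' M'P] := run_converges j.+1 (ev e e 0) cvg.
    exists (maxn M M') => n; rewrite geq_max => /andP[Mn M'n] i.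
    by rewrite leq_eqVlt => /orP[/eqP ->|/MP]; [exact: M'P|apply].
  have [M MP] := conv; exists (maxn k M) => n.
  rewrite geq_max => /andP[kn Mn].
  (* Beyond step [k] both runs are frozen in the same halted state. *)
  have hall n' i : M <= n' -> run (h_ n') i (ev e e 0) = run h i (ev e e 0).
    move=> Mn'; have [ik|ki] := leqP i k; first exact: MP.
    rewrite (run_stable (ltnW ki) hk) -(MP n' Mn' k (leqnn k)).
    by apply: run_stable (ltnW ki) _; rewrite MP.
  apply/andP; split; first by rewrite /stops hall // (run_stable kn hk).
  by apply/allP => i _; rewrite !hall // ltnW.
exists N; have [M MP] := run_converges N (ev e e 0) cvg.
(* Consecutive agreements carry the state after [N] steps, halted at stage [N], to all later stages
   and hence to the limit. *)
have same n : N <= n -> run (h_ n) N (ev e e 0) = run (h_ N) N (ev e e 0).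
  elim: n => [|n IH]; first by rewrite leqn0 => /eqP <-.
  rewrite leq_eqVlt => /orP[/eqP <- //|]; rewrite ltnS => Nn.
  have /andP[_ /allP/(_ N)] := settles _ Nn.
  by rewrite mem_iota /= add0n ltnS Nn => /(_ isT)/eqP <-; exact: IH.
have := settles _ (leqnn N) => /andP[hN _].
by rewrite /stops -(MP (maxn N M)) ?leq_maxr // same // leq_maxl.
Qed.

(** * Stages of a c.e. set and the set of wrong stages *)

Definition stage (b t x : nat) : bool := stops (fun=> 0) t b x.

Lemma WstdP b x : Wstd b x <-> exists t, stage b t x.
Proof. by rewrite /Wstd /= halts_stops chi_set0. Qed.

Lemma stageW b t x : stage b t x -> Wstd b x.
Proof. by move=> sx; apply/WstdP; exists t. Qed.

Lemma cmp_stage X b t x : cmp X t -> cmp X x ->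
  cmpb X (fun n => stage b (t n) (x n)).
Proof.
by move=> ct cx; apply: (@cmp_stops _ (fun _ _ => 0)) => //; exact: cmp_cst.
Qed.

(** The set [A]. A stage never contains a false element, so it can differ from the limit only by
    missing one. *)
Definition wrong_stages (b : nat) : set nat :=
  [set m | exists2 x, x <= pi2 m & Wstd b x /\ ~~ stage b (pi1 m) x].

Lemma right_stageP b t n : ~ wrong_stages b (pr t n) ->
  forall x, x <= n -> stage b t x = `[< Wstd b x >].
Proof.
move=> At x xn; apply/idP/asboolP => [/stageW //|Bx].
by apply: contrapT => /negP sx; apply: At; exists x; rewrite !prE.
Qed.

Lemma right_stage_ex b n : exists t, ~ wrong_stages b (pr t n).
Proof.
have [t tP] : exists t, forall x, x < n.+1 -> Wstd b x -> stage b t x.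
  elim: n.+1 => [|m [t IH]]; first by exists 0.
  have [/WstdP[s ms]|nBm] := pselect (Wstd b m); last first.
    by exists t => x; rewrite ltnS leq_eqVlt => /orP[/eqP ->|/IH].
  exists (maxn t s) => x; rewrite ltnS leq_eqVlt => /orP[/eqP ->|xm Bx].
    by move=> _; apply: stops_mono ms; exact: leq_maxr.
  by apply: stops_mono (IH _ xm Bx); exact: leq_maxl.
by exists t => -[x]; rewrite !prE => xn [Bx /negP]; apply; exact: tP.
Qed.

Lemma wrong_stages_ce b : ce (wrong_stages b).
Proof.
(* The witness [y] pairs a missing element with a stage at which it is present. *)
have [|c cP] := @cmp_dom set0 (fun m y => [&& pi1 y <= pi2 m,
    stage b (pi2 y) (pi1 y) & ~~ stage b (pi1 m) (pi1 y)]).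
  by cmp_tac; apply: cmp_stage; cmp_tac.
exists (encode c); apply/seteqP; split=> m.
  move=> [x xm [/WstdP[t tx] sx]]; apply/halts_encode/cP; exists (pr x t).
  by rewrite !prE xm tx.
move=> /halts_encode/cP[y /and3P[ym ty sy]].
by exists (pi1 y) => //; split=> //; exact: stageW ty.
Qed.

(** One direction is a bounded search with oracle [Wstd b]; in the other, the least stage right up
    to [x], found by querying [wrong_stages b], decides [x]. *)
Lemma wrong_stages_equiv b : turing_equiv (wrong_stages b) (Wstd b).
Proof.
split; apply/turing_leE.
  apply: (eq_cmp (f := fun m => ~~ all (fun x => ~~ `[< Wstd b x >] ||
    stage b (pi1 m) x) (iota 0 (pi2 m).+1))).
    move=> m; congr nat_of_bool; apply/allPn/asboolP.
      move=> [x]; rewrite mem_iota negb_or negbK add0n ltnS.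
      by move=> xm /andP[/asboolP Bx sx]; exists x.
    move=> [x xm [Bx sx]]; exists x; first by rewrite mem_iota add0n ltnS.
    by rewrite negb_or negbK sx andbT; apply/asboolP.
  apply/cmpb_neg; apply: (@cmpb_all _ (fun m x => ~~ `[< Wstd b x >] ||
    stage b (pi1 m) x)); cmp_tac.
    by apply: (@cmp_comp _ (chi (Wstd b))); [exact: cmp_oracle|cmp_tac].
  by apply: cmp_stage; cmp_tac.
have /choice[tau tauP] x : exists t, ~ wrong_stages b (pr t x) /\
    forall i, i < t -> wrong_stages b (pr i x).
  have [t tP] := right_stage_ex b x.
  have ex : exists t, ~~ `[< wrong_stages b (pr t x) >] by exists t; apply/asboolPn.
  case: (ex_minnP ex) => m /asboolPn Am mmin; exists m; split=> // i im.
  by apply: contrapT => /asboolPn /mmin; lia.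
apply: (eq_cmp (f := fun x => stage b (tau x) x)).
  by move=> x; rewrite (right_stageP (tauP x).1).
apply: cmp_stage; last exact: cmp_id.
apply: (@cmp_mu _ (fun x t => ~~ `[< wrong_stages b (pr t x) >])).
  apply/cmpb_neg; apply: (@cmp_comp _ (chi (wrong_stages b))); last by cmp_tac.
  exact: cmp_oracle.
move=> x; have [tx ti] := tauP x; split; first exact/asboolPn.
by move=> i /ti; rewrite negbK => ?; apply/asboolP.
Qed.

(** * Approximations to the jump and the double jump as a limit condition *)

(* [2] is a stuck oracle answer: a computation that halts with [trunc p n] only
   asks questions below [n]. *)
Definition trunc (p : nat -> bool) (n x : nat) : nat :=
  if x < n then nat_of_bool (p x) else 2.

Definition jump_approx (p : nat -> bool) (n q : nat) : nat :=
  stops (trunc p n) n q q.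

(** The questions of a halting computation eventually lie below [n]. There are no false positives,
    since by [run_approx] halting with the truncated oracle carries over to [X]. *)
Lemma jump_approx_converges X :
  converges (jump_approx (fun x => `[< X x >])) (chi (jump X)).
Proof.
have cvg : converges (trunc (fun x => `[< X x >])) (chi X).
  by move=> x; exists x.+1 => n xn; rewrite /trunc xn.
move=> q; rewrite /jump_approx /chi.
have [jq|nj] := pselect (jump X q).
  rewrite (asboolT jq); have /halts_stops[k hk] := jq.
  have [N NP] := run_converges k (ev q q 0) cvg.
  exists (maxn k N) => n; rewrite geq_max => /andP[kn Nn].
  by rewrite (stops_mono kn) // /stops NP.
rewrite (asboolF nj); exists 0 => n _; case: (boolP (stops _ _ _ _)) => // hn.
case: nj; apply/halts_stops; exists n; rewrite /stops.
by rewrite (run_approx _ hn) // /trunc => x; case: ifP.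
Qed.

Definition unsettled (p : nat -> bool) (n e : nat) : bool :=
  ~~ settled (jump_approx p n) (jump_approx p n.+1) n e.

Lemma jump2P X e : jump (jump X) e <->
  eventually (fun n => ~~ unsettled (fun x => `[< X x >]) n e).
Proof.
rewrite /jump /= halts_stops (settledP _ (@jump_approx_converges X)).
by split=> -[N NP]; exists N => n /NP; rewrite negbK.
Qed.

(** * Reduction of the double jump to finiteness outside the wrong stages *)

Definition fresh (b t n : nat) : bool :=
  (t == 0) || ~~ all (fun x => ~~ stage b t x || stage b t.-1 x) (iota 0 n.+1).

Lemma cmp_trunc X b t k x : cmp X t -> cmp X k -> cmp X x ->
  cmp X (fun n => trunc (stage b (t n)) (k n) (x n)).
Proof.
by move=> ct ck cx; rewrite /trunc; cmp_tac; exact: cmp_stage.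
Qed.

Lemma cmp_jump_approx X b t k x : cmp X t -> cmp X k -> cmp X x ->
  cmp X (fun n => jump_approx (stage b (t n)) (k n) (x n)).
Proof.
move=> ct ck cx.
apply: (@cmp_stops _ (fun n => trunc (stage b (t n)) (k n))) => //.
apply: cmp_trunc; last by cmp_tac.
- by apply: cmp_comp ct _; cmp_tac.
- by apply: cmp_comp ck _; cmp_tac.
Qed.

Lemma cmp_unsettled X b t k e : cmp X t -> cmp X k -> cmp X e ->
  cmpb X (fun n => unsettled (stage b (t n)) (k n) (e n)).
Proof.
move=> ct ck ce.
have c1 f : cmp X f -> cmp X (fun z => f (pi1 z)).
  by move=> cf; apply: cmp_comp cf _; cmp_tac.
apply/cmpb_neg/cmpb_and.
  apply: (@cmp_stops _ (fun n => jump_approx (stage b (t n)) (k n))) => //.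
  by apply: cmp_jump_approx; [exact: c1|exact: c1|cmp_tac].
apply: (@cmpb_all _ (fun n i =>
  run (jump_approx (stage b (t n)) (k n)) i (ev (e n) (e n) 0) ==
  run (jump_approx (stage b (t n)) (k n).+1) i (ev (e n) (e n) 0))); last by cmp_tac.
have ce1 := c1 _ ce; have ct1 := c1 _ ct; have ck1 := c1 _ ck.
have ct2 := c1 _ ct1; have ck2 := c1 _ ck1.
apply: cmpb_eq;
  [apply: (@cmp_run _ (fun z => jump_approx (stage b (t (pi1 z))) (k (pi1 z))))
  |apply: (@cmp_run _ (fun z => jump_approx (stage b (t (pi1 z))) (k (pi1 z)).+1))].
all: try by rewrite /ev; cmp_tac.
all: by apply: cmp_jump_approx; cmp_tac.
Qed.

(** An instance of the s-m-n theorem. The search ignores its candidate, so it halts at 0 or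
    never. *)
Lemma ce_smn (p : nat -> nat -> bool) :
  cmpb set0 (fun z => p (pi1 z) (pi2 z)) ->
  exists2 g, cmp set0 g & forall e m, Wstd (g e) m <-> p e m.
Proof.
move=> cp; have [|u uP] := @cmp_dom set0 (fun z _ => p (pi1 z) (pi2 z)).
  apply: (@cmp_comp _ (fun z => nat_of_bool (p (pi1 z) (pi2 z)))) => //.
  by cmp_tac.
have [c cP] := cmp_id set0.
exists (fun e => encode (Comp u (Pair (kst e) c))).
  by rewrite /=; cmp_tac; exact/cmp_kst/cmp_id.
move=> e m; split.
  move=> /halts_encode[y [_ [_ [_ [/eval_kst -> /(eval_fun (cP m)) <- ->]]] uy]].
  by have [_] := (uP (pr e m)).1 (ex_intro _ y uy); rewrite !prE.
move=> pem; have [|y uy] := (uP (pr e m)).2; first by exists 0; rewrite !prE.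
apply/halts_encode; exists y, (pr e m) => //; exists e, m; split=> //; exact/eval_kst.
Qed.

Lemma finite_nat_eventually (S : set nat) :
  finite_set S <-> eventually (fun n => ~ S n).
Proof.
split=> [/finite_seqP[s ->]|[N NS]].
  exists (\max_(x <- s) x).+1 => n sn /= ns.
  by have := @leq_bigmax_seq _ s xpredT id n ns isT; rewrite leqNgt sn.
apply: (sub_finite_set _ (finite_II N)) => n Sn /=.
by rewrite ltnNge; apply/negP => /NS.
Qed.

Lemma jump2_finite b : exists2 g, cmp set0 g & forall e,
  jump (jump (Wstd b)) e <-> finite_set (Wstd (g e) `&` ~` wrong_stages b).
Proof.
have [|g cg gP] := @ce_smn (fun e m =>
    fresh b (pi1 m) (pi2 m) && unsettled (stage b (pi1 m)) (pi2 m) e).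
  apply: cmpb_and; last by apply: cmp_unsettled; cmp_tac.
  rewrite /fresh; cmp_tac.
  by apply: (@cmpb_all _ (fun z x => ~~ stage b (pi1 (pi2 z)) x ||
    stage b (pi1 (pi2 z)).-1 x)); cmp_tac; apply: cmp_stage; cmp_tac.
exists g => // e; rewrite jump2P.
have agree t n : ~ wrong_stages b (pr t n) ->
    unsettled (stage b t) n e = unsettled (fun x => `[< Wstd b x >]) n e.
  move=> /right_stageP sE.
  (* [unsettled] compares approximations [n] and [n.+1], so it reads its oracle only at arguments up
     to [n], where the stage is right. *)
  have tE k : k <= n.+1 -> trunc (stage b t) k = trunc (fun x => `[< Wstd b x >]) k.
    move=> kn; apply: funext => x; rewrite /trunc; case: ifP => // xk.
    by rewrite sE //; lia.
  by rewrite /unsettled /jump_approx !tE.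
(* [tau n] is the least stage right up to [n]; freshness is a decidable condition that singles it
   out among the right stages. *)
have /choice[tau tauP] n : exists t, [/\ ~ wrong_stages b (pr t n), fresh b t n &
    forall t', ~ wrong_stages b (pr t' n) -> fresh b t' n -> t' = t].
  have ex : exists t, ~~ `[< wrong_stages b (pr t n) >].
    by have [t tP] := right_stage_ex b n; exists t; apply/asboolPn.
  case: (ex_minnP ex) => t /asboolPn At tmin; exists t; split=> //.
    (* By minimality the preceding stage misses some element up to [n], which is now present. *)
    case: t At tmin => // t At tmin; apply/allPn.
    have [x] : wrong_stages b (pr t n).
      by apply: contrapT => /asboolPn /tmin; rewrite ltnn.
    rewrite !prE => xn [Bx sx]; exists x; first by rewrite mem_iota add0n ltnS.
    by rewrite negb_or negbK sx (right_stageP At) // asboolT.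
  move=> t' At' /orP[/eqP t0|/allPn[x]].
    by have /tmin := introT (asboolPn _) At'; rewrite t0 leqn0 => /eqP.
  rewrite mem_iota add0n ltnS negb_or negbK => xn /andP[st' st'1].
  have /tmin := introT (asboolPn _) At'; rewrite leq_eqVlt => /orP[/eqP //|tt'].
  (* A right stage after [t] is not fresh: everything it contains up to [n] is already present at
     [t], hence at [t'.-1]. *)
  case/negP: st'1; apply: (stops_mono (j := t)); first lia.
  by rewrite -/(stage b t x) (right_stageP At) // asboolT //; exact: stageW st'.
have -> : Wstd (g e) `&` ~` wrong_stages b = (fun n => pr (tau n) n) @`
    [set n | unsettled (fun x => `[< Wstd b x >]) n e].
  apply/seteqP; split=> m /=.
    move=> [/gP/andP[fm um] Am]; move: Am; rewrite -(pr_pi m) => Am.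
    exists (pi2 m); first by rewrite /= -(agree _ _ Am).
    by have [_ _ /(_ _ Am fm) <-] := tauP (pi2 m).
  move=> [n un <-]; have [An fn _] := tauP n; split=> //.
  by apply/gP; rewrite !prE fn agree.
(* Finiteness passes back along the image because [pi2] recovers [n] from [pr (tau n) n]. *)
split=> [[N NP]|/(finite_image pi2)].
  apply/finite_image/finite_nat_eventually; exists N => n /NP.
  by move=> /negP.
rewrite image_comp; set S := _ @` _.
have -> : S = [set n | unsettled (fun x => `[< Wstd b x >]) n e].
  apply/seteqP; split=> n /=; first by move=> [m um]; rewrite /= prE => <-.
  by move=> un; exists n => //=; rewrite prE.
move=> /finite_nat_eventually[N NP]; exists N => n /NP nu.
exact/negP.
Qed.

Theorem corollary6p2 (W : nat -> set nat) (hW : acceptable W)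
    (B : set nat) (hB : ce B) (hB2 : nonlow2 B) :
  exists A : set nat,
    [/\ ce A, turing_equiv A B, ~ semilow2 W (~` A) & ~ semilow1_5 W (~` A)].
Proof.
have [b BE] := hB; subst B.
(* The converse reduction always holds by monotonicity of the jump, so being nonlow must refute this
   one. *)
have nle : ~ turing_le (jump (jump (Wstd b))) (jump (jump set0)).
  move=> le; apply: hB2; split=> //; do 2 apply: jump_mono.
  by apply/turing_leE; rewrite chi_set0; exact: cmp_cst.
have [_ [w [_ /computableE cw _ wP]]] := hW.
have [g cg gP] := jump2_finite b.
have cwg : cmp (jump (jump set0)) (fun e => w (g e)).
  by apply: cmp_set0; exact: cmp_comp cw cg.
exists (wrong_stages b); split.
- exact: wrong_stages_ce.
- exact: wrong_stages_equiv.
(* Semilowness decides infinity, so its negation at the index [w (g e)] would decide the double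
   jump. *)
- move=> /turing_leE cS; apply/nle/turing_leE.
  apply: eq_cmp (cmpb_neg (cmp_comp cS cwg)) => e.
  congr nat_of_bool; rewrite -asbool_neg; apply: asbool_equiv_eq.
  by rewrite /= notK gP wP.
(* Here finiteness itself is reduced by [f], so one oracle question at [f (w (g e))] would
   suffice. *)
- move=> [f [/computableE/(cmp_set0 (jump (jump set0))) cf _ fP]].
  apply/nle/turing_leE.
  apply: eq_cmp (cmp_comp (cmp_oracle _) (cmp_comp cf cwg)) => e.
  congr nat_of_bool; apply: asbool_equiv_eq.
  by rewrite gP wP -fP.
Qed.
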